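(* Let $\mathbb{K}$ be a field of characteristic different from $2$, and let $n\ge 2$. Then $\mathrm{SL}(M_n(\mathbb{K}))\subseteq \mathrm{JMS}(M_n(\mathbb{K})^+)$, where $\mathrm{SL}(M_n(\mathbb{K}))$ is the group of $\mathbb{K}$-linear automorphisms of determinant $1$ of the $n^2$-dimensional vector space $M_n(\mathbb{K})$. Equivalently, after choosing any $\mathbb{K}$-basis of $M_n(\mathbb{K})$, the semigroup $\mathrm{JMS}(M_n(\mathbb{K})^+)$ contains every elementary transvection of $\mathrm{SL}_{n^2}(\mathbb{K})$ and therefore the whole group $\mathrm{SL}_{n^2}(\mathbb{K})$.
   Context: $M_n(\mathbb{K})^+$ is the Jordan algebra of $n\times n$ matrices over $\mathbb{K}$ with product $A\circ B:=\frac12(AB+BA)$. For $A\in M_n(\mathbb{K})$, $\mathrm{L}_A(X):=A\circ X$. $\mathrm{JMS}(M_n(\mathbb{K})^+)$ is the subsemigroup (under composition) of $\mathrm{End}_{\mathbb{K}}(M_n(\mathbb{K}))$ (all $\mathbb{K}$-linear endomorphisms of the vector space $M_n(\mathbb{K})$) generated by all $\mathrm{L}_A$, $A\in M_n(\mathbb{K})$. Given a basis $(b_1,\dots,b_d)$ of a vector space $W$, the elementary transvections are the operators $\mathrm{id}_W+t\,\varepsilon_{ij}$ ($i\ne j$, $t\in\mathbb{K}$), where $\varepsilon_{ij}$ sends $b_j$ to $b_i$ and all other basis vectors to $0$. *)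

(* Defs.v *)
From HB Require Import structures.
From mathcomp Require Import all_boot all_order all_algebra.

Set Implicit Arguments.
Unset Strict Implicit.
Unset Printing Implicit Defensive.

Import GRing.Theory passmx.
Local Open Scope ring_scope.

Section Endomorphisms.
Variables (K : fieldType) (V : vectType K).

(* [mxof] acts on row vectors, so it is the transpose of the usual matrix of f;
   this does not affect the determinant. The choice of basis is immaterial,
   see [endo_detE]. *)
Definition endo_det (f : 'End(V)) : K :=
  \det (mxof (vbasis {:V}) (vbasis {:V}) f).

Lemma endo_detE (e : (\dim {:V}).-tuple V) (f : 'End(V)) :
  basis_of {:V} e -> \det (mxof e e f) = endo_det f.
Proof.
move=> eB; have vB := vbasisP {:V}; rewrite /endo_det.
set v := vbasis {:V} in vB *.
have -> : mxof e e f = mxof e v \1%VF *m mxof v v f *m mxof v e \1%VF.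
  by rewrite -!mxof_comp // comp_lfun1l comp_lfun1r.
rewrite !det_mulmx mulrAC -[RHS]mul1r; congr (_ * _).
by rewrite -det_mulmx -mxof_comp // comp_lfun1l mxof1 ?det1 ?(basis_free eB).
Qed.

Definition in_SL (f : 'End(V)) : Prop := bijective f /\ endo_det f = 1.

Section ElementaryTransvections.
Variables (d : nat) (b : d.-tuple V).

(* The vector v is sent to (its b_j-coordinate) * b_i, so that b_j goes to b_i
   and every other basis vector to 0, see [elem_endo_basis]. *)
Definition elem_fun (i j : 'I_d) (v : V) : V := coord b j v *: b`_i.

Lemma elem_fun_linear i j : linear (elem_fun i j).
Proof. by move=> a u v; rewrite /elem_fun linearP /= scalerDl scalerA. Qed.

HB.instance Definition _ i j :=
  GRing.isSemilinear.Build K V V _ (elem_fun i j)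
    (GRing.semilinear_linear (elem_fun_linear i j)).

Definition elem_endo (i j : 'I_d) : 'End(V) := linfun (elem_fun i j).

Definition elem_transvection (i j : 'I_d) (t : K) : 'End(V) :=
  \1%VF + t *: elem_endo i j.

Lemma elem_endo_basis (i j k : 'I_d) : basis_of {:V} b ->
  elem_endo i j b`_k = if k == j then b`_i else 0.
Proof.
move=> bB; rewrite lfunE /= /elem_fun coord_free ?(basis_free bB) //.
by case: eqP => _; rewrite ?scale1r ?scale0r.
Qed.

End ElementaryTransvections.
End Endomorphisms.

Section JordanMatrices.
Variables (K : fieldType) (n : nat).
Implicit Types A X : 'M[K]_n.

Definition jordan_mul A X : 'M[K]_n := 2%:R^-1 *: (A *m X + X *m A).

Lemma jordan_mul_linear A : linear (jordan_mul A).
Proof.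
move=> a X Y; rewrite /jordan_mul mulmxDr mulmxDl -scalemxAr -scalemxAl.
by rewrite addrACA -scalerDr [LHS]scalerDr !scalerA mulrC.
Qed.

HB.instance Definition _ A :=
  GRing.isSemilinear.Build K 'M[K]_n 'M[K]_n _ (jordan_mul A)
    (GRing.semilinear_linear (jordan_mul_linear A)).

Definition jordan_L A : 'End('M[K]_n) := linfun (jordan_mul A).

Lemma jordan_LE A X : jordan_L A X = 2%:R^-1 *: (A *m X + X *m A).
Proof. by rewrite lfunE. Qed.

Inductive JMS : 'End('M[K]_n) -> Prop :=
| JMS_L A : JMS (jordan_L A)
| JMS_comp f g : JMS f -> JMS g -> JMS (f \o g)%VF.

Lemma dim_Mn : \dim {:'M[K]_n} = (n ^ 2)%N.
Proof. by rewrite dimvf. Qed.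

End JordanMatrices.

(* Main.v *)
Require Import Defs.
From mathcomp Require Import all_boot all_order all_algebra all_fingroup.
From mathcomp Require Import ring.
Set Implicit Arguments.
Unset Strict Implicit.
Import GRing.Theory passmx.
Local Open Scope ring_scope.

(** The determinant-one group of a vector space is generated by elementary
    transvections, so it suffices to write each of these as a product of
    operators L_A. With respect to the trace form every operator of rank one is
    X |-> tr(P X) Q; write tv Q P for X |-> X + tr(P X) Q. It is a transvection
    when tr(P Q) = 0.

    The first transvections come from a matrix unit N = E_ij, i <> j. As N^2 = 0
    and N X N = tr(N X) N, the product of L_(1 + 2sN) and L_(1 - 2sN) collapses
    to tv N (-2 s^2 N) ([jms_tv_neg]). The coefficient is always minus twice a
    square, and over an ordered field its sign has to be reversed
    ([jms_tv_pos]):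
    - In characteristic 3, 5 or 7 a power of the transvection is its inverse.
    - In any other characteristic let F be the permutation matrix exchanging i and j.
      The operators L_(a + bF) L_(a - bF) are scalar on the even part and on
      the odd part of X |-> F X F, with eigenvalues a^2 - b^2 and a^2. Since
      3^2 + 4^2 = 5^2, the choices (3, 5) and (4, 5) give (-16, 9) and (-9, 16),
      hence two operators inverse to each other up to the scalar 144.
      Conjugating tv N (-2 r^2 N) by the square of the first one gives a
      second transvection. For a suitable r the two satisfy the braid relation
      and their product has finite order, as for [[1, 1], [0, 1]] and
      [[1, 0], [-1, 1]] in SL_2(Z); so the inverse of the first is a product
      of both ([jms_tv_braid]).
    Every t is 2 (a^2 - b^2), so tv N (t N) is obtained for all t
    ([full_tv_delta]).

    The relation full_tv Q P, meaning that tv Q (t P) is obtained for all t, is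
    symmetric because each L_A is self-adjoint for the trace form
    ([full_tv_sym]), additive in each argument, invariant under conjugation by
    GL_n, and closed under commutators ([full_tv_commutator]). Conjugating by a
    unipotent L_A moves (E_ij, E_ij) to a pair from which a commutator extracts
    (E_ij, E_ii + E_jj) ([full_tv_block_id]); conjugations in GL_n and further
    commutators then give all (E_ij, E_kl) with (k, l) <> (j, i)
    ([full_tv_delta_all]), and these are the elementary transvections of the
    basis of matrix units. *)

(** * Generation of SL_d by elementary matrices *)

Section SpecialLinear.
Variable K : fieldType.

Definition elementary_closed d (S : 'M[K]_d -> Prop) : Prop :=
  [/\ S 1%:M, forall A B, S A -> S B -> S (A *m B) &
      forall i j t, i != j -> S (1%:M + t *: delta_mx i j)].

(** Reduces statements on rows to statements on columns. *)
Lemma elementary_closed_tr d (S : 'M[K]_d -> Prop) :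
  elementary_closed S -> elementary_closed (fun A => S A^T).
Proof.
case=> S1 SM SE; split=> [|A B SA SB|i j t ij]; first by rewrite trmx1.
  by rewrite trmx_mul; apply: SM.
by rewrite linearD linearZ /= trmx1 trmx_delta; apply: SE; rewrite eq_sym.
Qed.

(** The matrices 1 + c e_j with c_j = 0 multiply by adding the columns c, since
    e_j kills them; so it is enough to treat the entries of c one at a time. *)
Lemma elementary_closed_col {d} {S : 'M[K]_d -> Prop} {j : 'I_d} {c : 'cV[K]_d} :
  elementary_closed S -> c j 0 = 0 -> S (1%:M + c *m delta_mx 0 j).
Proof.
move=> [S1 SM SE] cj0.
pose P (u : 'cV[K]_d) := u j 0 = 0 /\ S (1%:M + u *m delta_mx 0 j).
suff [] : P c by [].
have -> : c = \sum_i c i 0 *: delta_mx i 0.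
  by rewrite [LHS]matrix_sum_delta; apply: eq_bigr => i _; rewrite big_ord1.
apply: (big_ind P) => [|u v [uj Su] [vj Sv]|i _].
- by split; rewrite ?mxE // mul0mx addr0.
- split; first by rewrite mxE uj vj addr0.
  suff -> : 1%:M + (u + v) *m delta_mx 0 j
     = (1%:M + u *m delta_mx 0 j) *m (1%:M + v *m delta_mx 0 j) by apply: SM.
  have jv0 : delta_mx 0 j *m v = 0 :> 'M_1.
    by rewrite -rowE; apply/matrixP=> a b; rewrite !ord1 !mxE.
  rewrite mulmxDl mul1mx mulmxDr mulmx1 mulmxA -[u *m _ *m v]mulmxA jv0.
  by rewrite mulmx0 mul0mx addr0 mulmxDl addrAC addrA addrAC.
- rewrite /P !mxE -scalemxAl mul_delta_mx eqxx andbT; have [<-|ji] := eqVneq j i.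
    by split; rewrite cj0 ?mul0r // scale0r addr0.
  by split; [rewrite mulr0 | apply: SE; rewrite eq_sym].
Qed.

Lemma elementary_closed_row {d} {S : 'M[K]_d -> Prop} {i : 'I_d} {r : 'rV[K]_d} :
  elementary_closed S -> r 0 i = 0 -> S (1%:M + delta_mx i 0 *m r).
Proof.
move=> /elementary_closed_tr cS ri0.
have /(elementary_closed_col cS) : r^T i 0 = 0 by rewrite mxE.
by rewrite linearD /= trmx1 trmx_mul trmxK trmx_delta.
Qed.

Lemma elementary_closed_cancel {d} {S : 'M[K]_d -> Prop} {i j : 'I_d} {t}
    {M : 'M[K]_d} :
  elementary_closed S -> i != j -> S ((1%:M + t *: delta_mx i j) *m M) -> S M.
Proof.
move=> [_ SM SE] ij SEM.
suff -> : M = (1%:M + (- t) *: delta_mx i j) *m ((1%:M + t *: delta_mx i j) *m M).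
  by apply: SM => //; apply: SE.
rewrite mulmxA [X in _ = X *m _]mulmxDl mul1mx mulmxDr mulmx1.
rewrite -scalemxAl -scalemxAr mul_delta_mx_cond eq_sym (negbTE ij) mulr0n.
by rewrite !scaler0 addr0 scaleNr addrK mul1mx.
Qed.

Lemma det_elementary d (i j : 'I_d) (t : K) :
  i != j -> \det (1%:M + t *: delta_mx i j) = 1.
Proof.
wlog lt_ji : i j / (j < i)%N => [th ij|ij].
  have [lt_ji|lt_ij|/val_inj eq_ij] := ltngtP j i; first exact: th.
    by rewrite -det_tr linearD linearZ /= trmx1 trmx_delta th // eq_sym.
  by rewrite eq_ij eqxx in ij.
rewrite det_trig.
  apply: big1 => k _; rewrite !mxE eqxx; case: (k =P i) => [->|_] /=.
    by rewrite (negbTE ij) mulr0 addr0.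
  by rewrite mulr0 addr0.
apply/is_trig_mxP=> a b lt_ab; rewrite !mxE -val_eqE (ltn_eqF lt_ab).
case: eqP => [ai|_]; case: eqP => [bj|_] /=; rewrite ?mulr0 ?addr0 //.
by move: lt_ab; rewrite ai bj ltnNge ltnW.
Qed.

(** Gaussian elimination by induction on the size: once the corner entry is 1,
    clearing its row and column leaves a block of determinant 1. A nonzero entry
    below the corner is used to turn the corner into 1, and if there is none the
    corner itself is nonzero and can be copied one row down. *)
Lemma SL_elementary d (S : 'M[K]_d -> Prop) :
  elementary_closed S -> forall M, \det M = 1 -> S M.
Proof.
elim: d S => [|m IH] S cS M detM; have [S1 SM SE] := cS.
  by rewrite [M](_ : _ = 1%:M) //; apply/matrixP=> [[]].
have corner (A : 'M[K]_(1 + m)) : \det A = 1 -> A 0 0 = 1 -> S A.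
  move=> detA A00.
  pose c := dlsubmx A; pose r := ursubmx A.
  have defA : A = block_mx 1%:M 0 c 1%:M
      *m block_mx 1%:M 0 0 (drsubmx A - c *m r) *m block_mx 1%:M r 0 1%:M.
    rewrite !mulmx_block !(mul1mx, mulmx1, mul0mx, mulmx0, addr0, add0r).
    rewrite addrC subrK -[LHS](submxK A) /c /r; congr block_mx.
    apply/matrixP=> a b; rewrite !ord1 !mxE eqxx.
    by rewrite -[RHS]A00; congr (A _ _); apply: val_inj.
  rewrite defA; apply: (SM); first apply: (SM).
  - have -> : block_mx 1%:M 0 c 1%:M
        = 1%:M + col_mx 0 c *m delta_mx 0 (lshift m (0 : 'I_1)).
      rewrite delta_mx_lshift mul_col_row scalar_mx_block add_block_mx.
      rewrite !(mul0mx, mulmx0, addr0, add0r).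
      by rewrite [delta_mx _ _](_ : _ = 1%:M) ?mulmx1 //;
        apply/matrixP=> a b; rewrite !ord1 !mxE.
    by apply: elementary_closed_col; rewrite // col_mxEu mxE.
  - pose S' B := S (block_mx (1%:M : 'M_1) 0 0 B).
    apply: (IH S'); first split.
    + by rewrite /S' -scalar_mx_block.
    + move=> B C SB SC; rewrite /S'.
      suff -> : block_mx (1%:M : 'M_1) 0 0 (B *m C)
          = block_mx 1%:M 0 0 B *m block_mx 1%:M 0 0 C by apply: SM.
      by rewrite mulmx_block !(mul1mx, mulmx1, mul0mx, mulmx0, addr0, add0r).
    + move=> i j t ij; rewrite /S'.
      have -> : block_mx (1%:M : 'M_1) 0 0 (1%:M + t *: delta_mx i j)
          = 1%:M + t *: delta_mx (rshift 1 i) (rshift 1 j) :> 'M_(1 + m).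
        rewrite delta_mx_dshift delta_mx_rshift scale_col_mx scale_row_mx.
        rewrite !scaler0 scalar_mx_block /block_mx add_col_mx !add_row_mx.
        by rewrite !addr0.
      by apply: SE; apply: contra_neq ij => /(@rshift_inj 1 m).
    + move: detA; rewrite {1}defA !det_mulmx det_lblock !det_ublock !det1.
      by rewrite !mul1r mulr1.
  - have -> : block_mx 1%:M r 0 1%:M
        = 1%:M + delta_mx (lshift m (0 : 'I_1)) 0 *m row_mx 0 r.
      rewrite delta_mx_ushift mul_col_row scalar_mx_block add_block_mx.
      rewrite !(mul0mx, mulmx0, addr0, add0r).
      by rewrite [delta_mx _ _](_ : _ = 1%:M) ?mul1mx //;
        apply/matrixP=> a b; rewrite !ord1 !mxE.
    by apply: elementary_closed_row; rewrite // row_mxEl mxE.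
have elemE (i j : 'I_m.+1) t (A : 'M[K]_m.+1) k :
    ((1%:M + t *: delta_mx i j) *m A) k 0 = A k 0 + t * (A j 0 *+ (k == i)).
  rewrite mulmxDl mul1mx -scalemxAl !mxE; congr (_ + _ * _).
  rewrite (bigD1 j) //= big1 ?addr0 => [|l /negbTE lj]; rewrite mxE.
    by rewrite eqxx andbT mulr_natl.
  by rewrite lj andbF mul0r.
have pivot (A : 'M[K]_m.+1) i : \det A = 1 -> i != 0 -> A i 0 != 0 -> S A.
  move=> detA i0 Ai0.
  have i0' : 0 != i by rewrite eq_sym.
  apply: (elementary_closed_cancel (t := (1 - A 0 0) / A i 0) cS i0').
  apply: corner; first by rewrite det_mulmx det_elementary // mul1r.
  by rewrite elemE eqxx divfK // addrC subrK.
have [M00|M00] := eqVneq (M 0 0) 1; first exact: corner.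
have [i /andP[i0 Mi0]|M0] := pickP (fun i => (i != 0) && (M i 0 != 0)).
  exact: pivot Mi0.
case: m => [|m] in IH S cS M detM S1 SM SE corner elemE pivot M00 M0 *.
  by rewrite det_mx11 in detM; rewrite detM eqxx in M00.
have M0E i : i != 0 -> M i 0 = 0.
  by move=> i0; move: (M0 i); rewrite i0 /= => /negbFE/eqP.
have M00' : M 0 0 != 0.
  apply: contraTneq isT => M000.
  move: detM; rewrite (expand_det_col _ 0) big1 => [/eqP|i _].
    by rewrite eq_sym oner_eq0.
  by have [->|/M0E ->] := eqVneq i 0; rewrite ?M000 mul0r.
have d10 : (lift 0 0 : 'I_m.+2) != 0 by [].
apply: (elementary_closed_cancel (t := 1) cS d10).
apply: (pivot _ (lift 0 0)) => //; first by rewrite det_mulmx det_elementary ?mul1r.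
by rewrite elemE eqxx mul1r (M0E _ d10) add0r.
Qed.

(** The indices are exchanged because [hommx] acts on row vectors. *)
Lemma elem_transvectionE (V : vectType K) (b : (\dim {:V}).-tuple V) i j t :
  basis_of {:V} b ->
  elem_transvection b i j t = hommx b b (1%:M + t *: delta_mx j i).
Proof.
move=> bB; rewrite linearD linearZ /= (hommx1 bB); congr (_ + _ *: _).
apply/lfunP=> v; rewrite lfunE /= (hommxE bB bB) /elem_fun.
suff -> : rVof b v *m delta_mx j i = coord b j v *: delta_mx 0 i.
  by rewrite linearZ /= vecof_delta.
rewrite [rVof b v]row_sum_delta mulmx_suml (bigD1 j) //= big1 => [|k kj].
  by rewrite -scalemxAl mul_delta_mx addr0 -coord_rVof.
by rewrite -scalemxAl mul_delta_mx_0 // scaler0.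
Qed.

End SpecialLinear.

(** * Operators in the Jordan multiplication semigroup *)

Section Jordan.
Variables (K : fieldType) (n : nat).
Hypothesis charK : 2%N \notin [pchar K].
Implicit Types (A N P Q X Y : 'M[K]_n) (s t : K).

(** Membership in the semigroup for plain functions, so that operators can be
    given by formulas without packaging their linearity. *)
Definition jms (F : 'M[K]_n -> 'M[K]_n) : Prop := exists2 f, JMS f & f =1 F.

Definition tv Q P X := X + \tr (P *m X) *: Q.

Definition full_tv Q P : Prop := forall t, jms (tv Q (t *: P)).

(** Twice the Jordan product. *)
Definition anti A X := A *m X + X *m A.

Local Notation "''E_' ( i , j )" := (delta_mx i j : 'M[K]_n)
  (at level 8, format "''E_' ( i ,  j )").

Lemma two_neq0 : 2%:R != 0 :> K.
Proof. by move: charK; rewrite inE. Qed.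

Lemma eq_jms F G : F =1 G -> jms F -> jms G.
Proof. by move=> FG [f Jf fF]; exists f => // X; rewrite fF. Qed.

Lemma JMS_of_jms (F : 'End('M[K]_n)) : jms F -> JMS F.
Proof. by move=> [f Jf fF]; rewrite -[F](_ : f = F) //; apply/lfunP. Qed.

Lemma jms_comp F G : jms F -> jms G -> jms (F \o G).
Proof.
move=> [f Jf fF] [g Jg gG]; exists (f \o g)%VF; first exact: JMS_comp.
by move=> X; rewrite comp_lfunE gG fF.
Qed.

(** This is the operator L_(s + 2tA). *)
Lemma jms_affine s t A : jms (fun X => s *: X + t *: anti A X).
Proof.
exists (jordan_L (s%:M + (2 * t) *: A)); first exact: JMS_L.
move=> X; rewrite jordan_LE mulmxDl mulmxDr mul_scalar_mx mul_mx_scalar.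
rewrite -!scalemxAl -!scalemxAr addrACA -!mulr2n -scalerDr -/(anti A X) -scalerA.
by rewrite -[s *: X *+ 2]scaler_nat -scalerDr scalerA mulVf ?two_neq0 ?scale1r.
Qed.

Lemma jms_scale s : jms (fun X => s *: X).
Proof. by apply: eq_jms (jms_affine s 0 0) => X; rewrite scale0r addr0. Qed.

Lemma jms_id : jms id.
Proof. by apply: eq_jms (jms_scale 1) => X; rewrite scale1r. Qed.

Lemma jms_iter F k : jms F -> jms (iter k F).
Proof.
move=> JF; elim: k => [|k IH]; first exact: jms_id.
exact: eq_jms (jms_comp JF IH).
Qed.

Lemma jms_linear F : jms F -> linear F.
Proof. by move=> [f _ fF] a X Y; rewrite -!fF linearP. Qed.

(** * The trace form and adjoints *)

Lemma mxtraceB A B : \tr (A - B) = \tr A - \tr B.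
Proof. exact: raddfB. Qed.

Lemma mxtraceN A : \tr (- A) = - \tr A.
Proof. exact: raddfN. Qed.

Lemma tr_delta_mul i j A : \tr ('E_(i, j) *m A) = A j i.
Proof.
rewrite /mxtrace (bigD1 i) //= big1 ?addr0 => [|k ki]; rewrite !mxE.
  rewrite (bigD1 j) //= big1 ?addr0 => [|k kj]; rewrite !mxE.
    by rewrite !eqxx mul1r.
  by rewrite (negbTE kj) andbF mul0r.
by rewrite big1 // => l _; rewrite !mxE (negbTE ki) mul0r.
Qed.

Lemma tr_delta_delta i j k l :
  \tr ('E_(i, j) *m 'E_(k, l)) = ((j == k) && (i == l))%:R.
Proof. by rewrite tr_delta_mul mxE. Qed.

(** Evaluates the trace of a product of two combinations of matrix units. *)
Definition tr_deltaE :=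
  (mulmxDl, mulmxDr, mulmxBl, mulmxBr, mulNmx, mulmxN, mxtraceD, mxtraceB, mxtraceN,
   tr_delta_delta, eqxx).

Lemma trace_form_inj A B : (forall X, \tr (A *m X) = \tr (B *m X)) -> A = B.
Proof.
move=> AB; apply/matrixP=> i j.
by rewrite -!(tr_delta_mul j i) mxtrace_mulC AB mxtrace_mulC.
Qed.

Lemma trace_anti A X Y : \tr (anti A X *m Y) = \tr (X *m anti A Y).
Proof.
rewrite mulmxDl mulmxDr !mxtraceD addrC; congr (_ + _); first by rewrite mulmxA.
by rewrite -mulmxA mxtrace_mulC mulmxA.
Qed.

(** Each L_A is self-adjoint, so the adjoint of a product of such operators is
    the product in reverse order. *)
Lemma jms_adjoint F : jms F ->
  exists2 G, jms G & forall X Y, \tr (F X *m Y) = \tr (X *m G Y).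
Proof.
move=> [f Jf fF]; suff [G JG fG] : exists2 G, jms G &
    forall X Y, \tr (f X *m Y) = \tr (X *m G Y).
  by exists G => // X Y; rewrite -fF.
elim: Jf => [A | g h _ [g' Jg' gE] _ [h' Jh' hE]] {f fF F}.
  exists (jordan_L A); first by exists (jordan_L A); first exact: JMS_L.
  move=> X Y; rewrite !jordan_LE -scalemxAl -scalemxAr !mxtraceZ.
  by congr (_ * _); apply: trace_anti.
exists (h' \o g'); first exact: jms_comp.
by move=> X Y; rewrite comp_lfunE gE hE.
Qed.

(** * Calculus of transvections *)

(** The adjoint of tv Q P is tv P Q. *)
Lemma jms_tv_sym Q P : jms (tv Q P) -> jms (tv P Q).
Proof.
case/jms_adjoint=> G JG GE; apply: eq_jms JG => Y.
apply: trace_form_inj => X; rewrite mxtrace_mulC -GE [tv _ _ _ *m X]mulmxDl.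
rewrite mulmxDl !mxtraceD -!scalemxAl !mxtraceZ mxtrace_mulC; congr (_ + _).
by rewrite mulrC.
Qed.

Lemma tv_scale s Q P : tv (s *: Q) P =1 tv Q (s *: P).
Proof. by move=> X; rewrite /tv -scalemxAl mxtraceZ scalerA mulrC. Qed.

Lemma tv_comp_functional Q P P' :
  \tr (P *m Q) = 0 -> tv Q P \o tv Q P' =1 tv Q (P + P').
Proof.
move=> PQ X; rewrite /tv /= mulmxDr mxtraceD -scalemxAr mxtraceZ PQ mulr0.
by rewrite addr0 mulmxDl mxtraceD scalerDl addrA addrAC.
Qed.

Lemma full_tv_sym Q P : full_tv Q P -> full_tv P Q.
Proof. by move=> T t; apply/(eq_jms (tv_scale t P Q))/jms_tv_sym/T. Qed.

Lemma full_tvD Q P P' : \tr (P *m Q) = 0 ->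
  full_tv Q P -> full_tv Q P' -> full_tv Q (P + P').
Proof.
move=> PQ T T' t; rewrite scalerDr.
by apply: eq_jms (jms_comp (T t) (T' t)); apply: tv_comp_functional;
  rewrite -scalemxAl mxtraceZ PQ mulr0.
Qed.

Lemma full_tvZ s Q P : full_tv Q P -> full_tv Q (s *: P).
Proof. by move=> T t; rewrite scalerA; apply: T. Qed.

Lemma full_tvB Q P P' : \tr (P *m Q) = 0 ->
  full_tv Q P -> full_tv Q P' -> full_tv Q (P - P').
Proof. by move=> PQ T T'; rewrite -scaleN1r; apply/full_tvD/full_tvZ. Qed.

(** Here H is a right inverse of G, and P' is the image of P under the adjoint
    of H. *)
Lemma jms_conj_tv G H Q P P' : jms G -> jms H -> cancel H G ->
  (forall X, \tr (P *m H X) = \tr (P' *m X)) ->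
  jms (tv Q P) -> jms (tv (G Q) P').
Proof.
move=> JG JH HK PH T; apply: eq_jms (jms_comp JG (jms_comp T JH)) => X.
rewrite /tv /= PH [H X + _]addrC (jms_linear JG) HK addrC //.
Qed.

Lemma full_tv_conj G H Q P P' : jms G -> jms H -> cancel H G ->
  (forall X, \tr (P *m H X) = \tr (P' *m X)) ->
  full_tv Q P -> full_tv (G Q) P'.
Proof.
move=> JG JH HK PH T t; apply: jms_conj_tv JG JH HK _ (T t) => X.
by rewrite -!scalemxAl !mxtraceZ PH.
Qed.

(** With c = tr(P Q'), conjugating tv Q' P' by tv Q P gives tv (Q' + c Q) P',
    because tr(P' Q) = 0; dividing by tv Q' P' leaves tv (c Q) P'. *)
Lemma full_tv_commutator Q P Q' P' :
  \tr (P *m Q) = 0 -> \tr (P' *m Q') = 0 -> \tr (P' *m Q) = 0 ->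
  \tr (P *m Q') != 0 -> full_tv Q P -> full_tv Q' P' -> full_tv Q P'.
Proof.
move=> PQ P'Q' P'Q PQ' T T'; set c := \tr (P *m Q') in PQ'.
have JP : jms (tv Q P) by have := T 1; rewrite scale1r.
have JNP : jms (tv Q (- P)) by have := T (-1); rewrite scaleN1r.
have NK : cancel (tv Q (- P)) (tv Q P).
  move=> X; rewrite -[LHS]/((tv Q P \o tv Q (- P)) X) tv_comp_functional //.
  by rewrite /tv subrr mul0mx mxtrace0 scale0r addr0.
have /(full_tv_conj JP JNP NK) T'' : forall X, \tr (P' *m tv Q (- P) X) = \tr (P' *m X).
  by move=> X; rewrite mulmxDr mxtraceD -scalemxAr mxtraceZ P'Q mulr0 addr0.
have {T''}/full_tv_sym T'' := T'' _ T'.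
suff /(full_tvZ c^-1)/full_tv_sym : full_tv P' (c *: Q).
  by rewrite scalerA mulVf // scale1r.
have -> : c *: Q = tv Q P Q' - Q' by rewrite [tv Q P Q']addrC addrK.
apply: full_tvB T'' (full_tv_sym T').
by rewrite mulmxDl mxtraceD -scalemxAl mxtraceZ ![\tr (_ *m P')]mxtrace_mulC
           P'Q' P'Q mulr0 addr0.
Qed.

(** Conjugation by g is an automorphism of the Jordan algebra, so it carries
    L_A to L_(g A g^-1). *)
Lemma jms_GL g F : g \in unitmx -> jms F ->
  jms (fun X => g *m F (invmx g *m X *m g) *m invmx g).
Proof.
move=> ug [f Jf fF].
apply: (@eq_jms (fun X => g *m f (invmx g *m X *m g) *m invmx g)).
  by move=> X; rewrite fF.
elim: Jf => [A | p q _ Jp _ Jq] {f fF F}.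
  exists (jordan_L (g *m A *m invmx g)); first exact: JMS_L.
  move=> X; rewrite !jordan_LE -scalemxAr -scalemxAl; congr (_ *: _).
  by rewrite mulmxDr mulmxDl !mulmxA mulmxV // mul1mx mulmxK //.
apply: eq_jms (jms_comp Jp Jq) => X /=.
by rewrite !mulmxA mulVmx // mul1mx mulmxKV // comp_lfunE.
Qed.

Lemma full_tv_GL g h Q P : h *m g = 1%:M ->
  full_tv Q P -> full_tv (g *m Q *m h) (g *m P *m h).
Proof.
move=> hg T t; have [uh ug] := mulmx1_unit hg.
have -> : h = invmx g by rewrite -[LHS](mulmxK ug) hg mul1mx.
apply: eq_jms (jms_GL ug (T t)) => X.
rewrite /tv mulmxDr mulmxDl !mulmxA mulmxV // mul1mx mulmxK //.
congr (_ + _); rewrite -[g *m (_ *: Q)]scalemxAr -[LHS]scalemxAl; congr (_ *: _).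
by rewrite -!scalemxAl !mxtraceZ [in LHS]mxtrace_mulC !mulmxA.
Qed.

(** * Transvections along a nilpotent matrix unit *)

(** On the plane of Q and Q', the two transvections a and b generate a copy of
    SL_2, where they satisfy a b a = b a b and w = a b a has square -1. Hence
    w^4 = 1, also on the whole space, and the inverse of a is b a w^3. *)
Lemma jms_tv_braid Q P Q' P' :
  \tr (P *m Q) = 0 -> \tr (P' *m Q') = 0 ->
  \tr (P *m Q') * \tr (P' *m Q) = -1 ->
  jms (tv Q P) -> jms (tv Q' P') -> jms (tv Q (- P)).
Proof.
move=> PQ P'Q'; set c := \tr (P *m Q'); set d := \tr (P' *m Q) => cd Ja Jb.
set a := tv Q P in Ja; set b := tv Q' P' in Jb.
pose st X x y := X + x *: Q + y *: Q'.
have aE X x y : a (st X x y) = st X (x + \tr (P *m X) + c * y) y.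
  rewrite /a /tv /st !mulmxDr !mxtraceD -!scalemxAr !mxtraceZ PQ -/c.
  by move: (\tr _) => p; apply/matrixP=> i j; rewrite !mxE; ring.
have bE X x y : b (st X x y) = st X x (y + \tr (P' *m X) + d * x).
  rewrite /b /tv /st !mulmxDr !mxtraceD -!scalemxAr !mxtraceZ P'Q' -/d.
  by move: (\tr _) => p; apply/matrixP=> i j; rewrite !mxE; ring.
have wE X x y : a (b (a (st X x y))) =
    st X (\tr (P *m X) + c * (\tr (P' *m X) + y))
         (\tr (P' *m X) + d * (\tr (P *m X) + x)).
  rewrite aE bE aE; congr st; first by ring: cd.
  by ring: cd.
pose w := a \o b \o a.
have Jw : jms w by apply: jms_comp => //; apply: jms_comp.
have w4 X : w (w (w (w X))) = X.
  have stX : X = st X 0 0 by rewrite /st !scale0r !addr0.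
  rewrite {1}stX /w /= !wE [RHS]stX; congr st; by ring: cd.
apply: (@eq_jms (b \o a \o w \o w \o w)).
  move=> X; rewrite -[in RHS](w4 X) {4}/w /=.
  rewrite -[a (b _)]/(tv Q P _) -[RHS]/((tv Q (- P) \o tv Q P) _).
  rewrite tv_comp_functional; last by rewrite mulNmx raddfN /= PQ oppr0.
  by rewrite addNr /tv mul0mx mxtrace0 scale0r addr0.
exact: (jms_comp (jms_comp (jms_comp (jms_comp Jb Ja) Jw) Jw) Jw).
Qed.

Lemma delta_sandwich i j k l X :
  'E_(i, j) *m X *m 'E_(k, l) = X j k *: 'E_(i, l).
Proof.
have mid : delta_mx 0 j *m X *m delta_mx k 0 = (X j k)%:M :> 'M_1.
  by rewrite -rowE -colE; apply/matrixP=> a b; rewrite !ord1 !mxE.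
rewrite -(mul_delta_mx (0 : 'I_1) i j) -(mul_delta_mx (0 : 'I_1) k l).
transitivity (delta_mx i (0 : 'I_1) *m (delta_mx 0 j *m X *m delta_mx k 0) *m delta_mx (0 : 'I_1) l).
  by rewrite !mulmxA.
by rewrite mid mul_mx_scalar -scalemxAl mul_delta_mx.
Qed.

Lemma anti_anti A X :
  anti A (anti A X) = A *m A *m X + (A *m X *m A) *+ 2 + X *m (A *m A).
Proof.
by rewrite /anti mulmxDr mulmxDl !mulmxA mulr2n !addrA.
Qed.

Lemma antiD A X Y : anti A (X + Y) = anti A X + anti A Y.
Proof. by rewrite /anti mulmxDr mulmxDl addrACA. Qed.

Lemma antiZ A s X : anti A (s *: X) = s *: anti A X.
Proof. by rewrite /anti -scalemxAr -scalemxAl scalerDr. Qed.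

Definition unip s i j X := X + s *: anti 'E_(i, j) X.

Lemma jms_unip s i j : jms (unip s i j).
Proof. by apply: eq_jms (jms_affine 1 s 'E_(i, j)) => X; rewrite scale1r. Qed.

(** The operators anti N of left plus right multiplication satisfy
    (anti N)^2 X = 2 N X N = 2 tr(N X) N when N is a nilpotent matrix unit, so
    (1 + s anti N)(1 - s anti N) is a transvection. *)
Lemma unip_comp s i j : i != j ->
  unip s i j \o unip (- s) i j =1 tv 'E_(i, j) (- (2 * s ^+ 2) *: 'E_(i, j)).
Proof.
move=> ij X; rewrite /unip /tv /= antiD antiZ anti_anti.
rewrite mul_delta_mx_0 1?eq_sym // mul0mx mulmx0 add0r addr0 delta_sandwich.
rewrite -scalemxAl mxtraceZ tr_delta_mul; move: (anti _ X) => Y.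
by apply/matrixP=> a b; rewrite !mxE; ring.
Qed.

Lemma jms_tv_neg s i j : i != j ->
  jms (tv 'E_(i, j) (- (2 * s ^+ 2) *: 'E_(i, j))).
Proof.
by move=> ij; apply: eq_jms (unip_comp s ij) _; apply: jms_comp; apply: jms_unip.
Qed.

(** This is L_(a + bF) L_(a - bF), which multiplies the F-even matrices by
    a^2 - b^2 and the F-odd ones by a^2. *)
Lemma jms_block F a b : F *m F = 1%:M ->
  jms (fun X => (a ^+ 2 - b ^+ 2 / 2) *: X - (b ^+ 2 / 2) *: (F *m X *m F)).
Proof.
move=> FF.
apply: eq_jms (jms_comp (jms_affine a (b / 2) F) (jms_affine a (- (b / 2)) F)) => X.
rewrite /= antiD !antiZ anti_anti FF mul1mx mulmx1.
move: (anti F X) (F *m X *m F) => Y Z.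
apply/matrixP=> i j; rewrite !mxE.
by field; apply: two_neq0.
Qed.

Lemma tperm_mx_delta i j :
  tperm_mx i j *m 'E_(i, j) *m tperm_mx i j = 'E_(j, i).
Proof.
rewrite -xrowE -xcolE; apply/matrixP=> a b; rewrite !mxE.
by rewrite !(canF_eq (tpermK i j)) tpermL tpermR.
Qed.

(** The inverse of the transvection of [jms_tv_neg]. The explicit construction
    only divides by 2, 3, 5 and 7, so it applies unless the characteristic is
    one of 3, 5, 7, where a power of the transvection serves instead. *)
Lemma jms_tv_pos s i j : i != j ->
  jms (tv 'E_(i, j) (2 * s ^+ 2 *: 'E_(i, j))).
Proof.
move=> ij; set N := 'E_(i, j); set N' := 'E_(j, i).
have ji : j != i by rewrite eq_sym.
have trNN : \tr (N *m N) = 0 by rewrite tr_delta_delta (negbTE ji).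
have trNN' : \tr (N *m N') = 1 by rewrite tr_delta_delta !eqxx.
have [->|s0] := eqVneq s 0.
  by apply: eq_jms jms_id => X; rewrite /tv expr0n mulr0 scale0r mul0mx mxtrace0 scale0r addr0.
have [/(natf0_pchar (isT : (0 < 3 * 5 * 7)%N)) [p charp]|nz105] :=
    boolP ((3 * 5 * 7)%:R == 0 :> K).
  have iterE k : iter k (tv N (- (2 * s ^+ 2) *: N)) =1
      tv N (- (2 * s ^+ 2 * k%:R) *: N).
    elim: k => [|k IH] X; first by rewrite /tv mulr0 oppr0 scale0r mul0mx mxtrace0 scale0r addr0.
    rewrite iterS IH -[LHS]/((_ \o _) X) tv_comp_functional.
      by rewrite -scalerDl -[in RHS]natr1; congr (tv _ (_ *: _) _); ring.
    by rewrite -scalemxAl mxtraceZ trNN mulr0.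
  apply: eq_jms (jms_iter p.-1 (jms_tv_neg s ij)) => X.
  rewrite iterE; congr (tv _ (_ *: _) _).
  have p0 : p.-1%:R = -1 :> K.
    apply: (addIr 1); rewrite natr1 prednK ?prime_gt0 ?(pcharf_prime charp) //.
    by rewrite (pcharf0 charp) addNr.
  by rewrite p0 mulrN1 opprK.
move: nz105; rewrite !natrM !mulf_eq0 !negb_or -andbA => /and3P[nz3 nz5 nz7].
have nz2 := two_neq0.
have nz144 : 144 != 0 :> K.
  by rewrite (_ : 144 = 2 ^+ 4 * 3 ^+ 2) ?mulf_neq0 ?expf_neq0 //; ring.
have nz175 : 175 != 0 :> K.
  by rewrite (_ : 175 = 5 ^+ 2 * 7) ?mulf_neq0 ?expf_neq0 //; ring.
have nz288 : 288 != 0 :> K.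
  by rewrite (_ : 288 = 2 * 144) ?mulf_neq0 //; ring.
pose F : 'M[K]_n := tperm_mx i j.
have FF : F *m F = 1%:M by rewrite /F /tperm_mx -perm_mxM tperm2 perm_mx1.
have FNF : F *m N *m F = N' by exact: tperm_mx_delta.
have FFX X : F *m (F *m X *m F) *m F = X.
  by rewrite !mulmxA FF mul1mx -mulmxA FF mulmx1.
have FN'F : F *m N' *m F = N by rewrite -FNF FFX.
(* G acts by -16 on the even part and by 9 on the odd part; 144 H acts there
   by -9 and 16. *)
pose G X := - (7 / 2) *: X - (25 / 2) *: (F *m X *m F).
pose H X := (144)^-1 *: ((7 / 2) *: X - (25 / 2) *: (F *m X *m F)).
have trE x y u v : \tr ((x *: N + y *: N') *m (u *: N + v *: N')) = x * v + y * u.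
  rewrite mulmxDl !mulmxDr -!scalemxAl -!scalemxAr !mxtraceD !mxtraceZ trNN trNN'.
  rewrite !tr_delta_delta !eqxx (negbTE ij) /=.
  by rewrite !mulr1 !mulr0 add0r addr0.
have JG : jms G.
  apply: eq_jms (jms_block 3 5 FF) => X; rewrite /G.
  by congr (_ *: _ - _ *: _); field; rewrite ?nz2.
have JH : jms H.
  apply: eq_jms (jms_comp (jms_scale 144^-1) (jms_block 4 5 FF)) => X /=.
  by congr (_ *: (_ *: _ - _ *: _)); field; rewrite ?nz2.
have HK : cancel H G.
  move=> X; rewrite /G /H -scalemxAr -scalemxAl mulmxBr mulmxBl.
  rewrite -!scalemxAr -!scalemxAl FFX; move: (F *m X *m F) => Y.
  by apply/matrixP=> a b; rewrite !mxE; field; rewrite ?nz2 ?nz144 ?nz288.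
have HN x y : H (x *: N + y *: N') =
    ((7 * x - 25 * y) / 288) *: N + ((7 * y - 25 * x) / 288) *: N'.
  rewrite /H mulmxDr mulmxDl -!scalemxAr -!scalemxAl FNF FN'F.
  by apply/matrixP=> a b; rewrite !mxE; field; rewrite ?nz2 ?nz144 ?nz288.
have GN x y : G (x *: N + y *: N') =
    (- (7 * x + 25 * y) / 2) *: N + (- (7 * y + 25 * x) / 2) *: N'.
  rewrite /G mulmxDr mulmxDl -!scalemxAr -!scalemxAl FNF FN'F.
  by apply/matrixP=> a b; rewrite !mxE; field; rewrite ?nz2 ?nz144 ?nz288.
have Hsym P X : \tr (P *m H X) = \tr (H P *m X).
  rewrite /H -scalemxAl -scalemxAr !mxtraceZ mulmxBl mulmxBr -!scalemxAl -!scalemxAr.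
  rewrite !raddfB /= !mxtraceZ; congr (_ * (_ - _ * _)).
  by rewrite mulmxA mxtrace_mulC !mulmxA.
have conjGH Q P : jms (tv Q P) -> jms (tv (G Q) (H P)).
  exact: jms_conj_tv JG JH HK (Hsym P).
(* G^2 N has E_ji-coordinate 175 / 2 and H^2 N has E_ji-coordinate
   - 175 / (2 * 144^2), so this r makes the product of the two cross traces
   4 s^2 r^2 * (175 / 2) * (- 175 / (2 * 144^2)) equal to -1. *)
pose r := 144 / (175 * s).
have /conjGH/conjGH := jms_tv_neg r ij.
have NE : N = 1 *: N + 0 *: N' by rewrite scale1r scale0r addr0.
have rNE : - (2 * r ^+ 2) *: N = - (2 * r ^+ 2) *: N + 0 *: N' by rewrite scale0r addr0.
rewrite -/N {1}NE rNE !GN !HN => JT.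
have := jms_tv_braid _ _ _ (jms_tv_neg s ij) JT.
rewrite scaleNr opprK; apply.
- by rewrite mulNmx -scalemxAl raddfN /= mxtraceZ trNN mulr0 oppr0.
- by rewrite trE; field; rewrite ?s0 ?nz175 ?nz288 ?nz2.
- have trl u v : \tr (N *m (u *: N + v *: N')) = v.
    by rewrite {1}NE trE mul1r mul0r addr0.
  have trr x y : \tr ((x *: N + y *: N') *m N) = y by rewrite mxtrace_mulC trl.
  rewrite mulNmx -scalemxAl raddfN /= mxtraceZ trl trr.
  by rewrite /r; field; rewrite ?s0 ?nz175 ?nz288 ?nz2.
Qed.

Lemma full_tv_delta i j : i != j -> full_tv 'E_(i, j) 'E_(i, j).
Proof.
move=> ij t.
have -> : t = 2 * ((t / 2 + 1) / 2) ^+ 2 + - (2 * ((t / 2 - 1) / 2) ^+ 2).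
  by field; apply: two_neq0.
rewrite scalerDl.
apply: eq_jms (jms_comp (jms_tv_pos _ ij) (jms_tv_neg _ ij)).
apply: tv_comp_functional; rewrite -scalemxAl mxtraceZ tr_delta_delta.
by rewrite eq_sym (negbTE ij) mulr0.
Qed.

(** * All transvections between matrix units *)

(** With M = E_ij, N = E_ji and e = E_ii + E_jj, the inverse G of
    1 - anti N moves the pair (M, M) to (M + e + 2N, M - e). Its commutator
    with (M, M) is (M, M - e), since tr(M (M + e + 2N)) = 2. *)
Lemma full_tv_block_id i j : i != j ->
  full_tv 'E_(i, j) ('E_(i, i) + 'E_(j, j)).
Proof.
move=> ij; have ji : j != i by rewrite eq_sym.
pose M := 'E_(i, j); pose N := 'E_(j, i); pose e := 'E_(i, i) + 'E_(j, j).
have fM : full_tv M M := full_tv_delta ij.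
have antiNM : anti N M = e by rewrite /anti !mul_delta_mx addrC.
pose G := tv N (2 *: N) \o unip 1 j i.
have JG : jms G by apply: jms_comp (jms_unip _ _ _); apply: full_tv_delta ji 2.
have HK : cancel (unip (-1) j i) G.
  move=> X; rewrite /G -[LHS]/(tv _ _ ((unip 1 j i \o unip (- 1) j i) X)) unip_comp //.
  rewrite -[LHS]/((tv _ _ \o _) X) tv_comp_functional.
    by rewrite expr1n mulr1 scaleNr subrr /tv mul0mx mxtrace0 scale0r addr0.
  by rewrite -scalemxAl mxtraceZ tr_delta_delta (negbTE ij) mulr0.
have MH X : \tr (M *m unip (-1) j i X) = \tr ((M - e) *m X).
  rewrite /unip mulmxDr mxtraceD -scalemxAr mxtraceZ.
  rewrite -trace_anti antiNM mulmxBl raddfB /=.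
  by rewrite mulN1r.
have fM' := full_tv_conj JG (jms_unip _ _ _) HK MH fM.
have GM : G M = M + e + 2 *: N.
  rewrite /G /= /unip scale1r antiNM /tv -scalemxAl mxtraceZ mulmxDr mulmxDr.
  rewrite !mxtraceD !tr_delta_delta !eqxx ?(negbTE ij) ?(negbTE ji) /=.
  by congr (_ + _ *: _); ring.
have MM : \tr (M *m M) = 0 by rewrite tr_delta_delta (negbTE ji).
have eM : \tr (e *m M) = 0.
  by rewrite !tr_deltaE ?(negbTE ij) ?(negbTE ji) /=; ring.
have fMM' : full_tv M (M - e).
  apply: full_tv_commutator fM fM' => //; rewrite ?GM.
  - rewrite !tr_deltaE -!scalemxAr !mxtraceZ !tr_deltaE.
    by rewrite ?(negbTE ij) ?(negbTE ji) /=; ring.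
  - by rewrite mulmxBl mxtraceB MM eM subr0.
  - suff -> : \tr (M *m (M + e + 2 *: N)) = 2 by exact: two_neq0.
    rewrite !tr_deltaE -!scalemxAr !mxtraceZ !tr_deltaE.
    by rewrite ?(negbTE ij) ?(negbTE ji) /=; ring.
rewrite -[_ + _]/e -[e](subKr M).
exact: full_tvB.
Qed.

(** Conjugation by 1 + E_ji fixes e = E_ii + E_jj and sends E_ij to
    E_ij - E_ji - h with h = E_ii - E_jj. So (e, h) is reached, and then
    (E_ij, h) by a commutator with (E_ij, e). *)
Lemma full_tv_delta_diag i j : i != j ->
  full_tv 'E_(i, j) 'E_(i, i) /\ full_tv 'E_(i, j) 'E_(j, j).
Proof.
move=> ij; have ji : j != i by rewrite eq_sym.
pose M := 'E_(i, j); pose N := 'E_(j, i); pose e := 'E_(i, i) + 'E_(j, j).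
pose h := 'E_(i, i) - 'E_(j, j).
have fMe : full_tv M e := full_tv_block_id ij.
have fNe : full_tv N e.
  by rewrite /e addrC; apply: full_tv_block_id.
have eM : \tr (e *m M) = 0.
  by rewrite !tr_deltaE ?(negbTE ij) ?(negbTE ji) /=; ring.
have eh : \tr (e *m h) = 0.
  by rewrite !tr_deltaE ?(negbTE ij) ?(negbTE ji) /=; ring.
have feh : full_tv e h.
  have NN : N *m N = 0 by rewrite mul_delta_mx_0.
  have gK : (1%:M - N) *m (1%:M + N) = 1%:M.
    by rewrite mulmxBl !mulmxDr !mul1mx !mulmx1 NN addr0 addrK.
  have eNN : e *m N = N.
    by rewrite mulmxDl mul_delta_mx_0 // mul_delta_mx add0r.
  have NeN : N *m e = N.
    by rewrite mulmxDr mul_delta_mx mul_delta_mx_0 // addr0.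
  have := full_tv_GL gK fMe.
  have -> : (1%:M + N) *m M *m (1%:M - N) = M - N - h.
    rewrite mulmxDl mul1mx mulmxBr mulmx1 mulmxDl !mul_delta_mx.
    by apply/matrixP=> a b; rewrite !mxE; ring.
  have -> : (1%:M + N) *m e *m (1%:M - N) = e.
    rewrite mulmxDl mul1mx NeN mulmxBr mulmx1 mulmxDl NN eNN addr0.
    by rewrite addrK.
  move=> /full_tv_sym fe; rewrite -[h](subKr (M - N)).
  apply: full_tvB (fe).
    by rewrite !tr_deltaE ?(negbTE ij) ?(negbTE ji) /=; ring.
  apply: full_tvB (full_tv_sym fMe) (full_tv_sym fNe).
  by rewrite !tr_deltaE ?(negbTE ij) ?(negbTE ji) /=; ring.
have fMh : full_tv M h.
  apply: full_tv_commutator fMe feh => //.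
  - by rewrite mxtrace_mulC.
  - by rewrite !tr_deltaE ?(negbTE ij) ?(negbTE ji) /=; ring.
  - by rewrite !tr_deltaE ?(negbTE ij) ?(negbTE ji) /= ?addr0 ?add0r two_neq0.
have half (P : 'M[K]_n) : full_tv M (2 *: P) -> full_tv M P.
  by move=> /(full_tvZ 2^-1); rewrite scalerA mulVf ?two_neq0 // scale1r.
split; apply: half; rewrite scaler_nat mulr2n.
- rewrite (_ : _ + _ = e + h); first by apply: full_tvD => //.
  by rewrite addrACA subrr addr0.
- rewrite (_ : _ + _ = e - h); first by apply: full_tvB => //.
  by rewrite [RHS]addrC opprB addrA subrK.
Qed.

(** The matrix 1 + E_ik commutes with E_ij and sends E_ii to E_ii - E_ik under
    conjugation. *)
Lemma full_tv_delta_row i j k : i != j -> k != i -> full_tv 'E_(i, j) 'E_(i, k).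
Proof.
move=> ij ki; have ik : i != k by rewrite eq_sym.
have ji : j != i by rewrite eq_sym.
have [fii _] := full_tv_delta_diag ij.
have gK : (1%:M - 'E_(i, k)) *m (1%:M + 'E_(i, k)) = 1%:M.
  by rewrite mulmxBl !mulmxDr !mul1mx !mulmx1 mul_delta_mx_0 // addr0 addrK.
have := full_tv_GL gK fii.
rewrite ![(1%:M + _) *m _]mulmxDl !mul1mx !(mul_delta_mx_0 _ _ _ ki) !addr0.
rewrite !mulmxBr !mulmx1 mul_delta_mx mul_delta_mx_0 // subr0 => f.
have -> : 'E_(i, k) = 'E_(i, i) - ('E_(i, i) - 'E_(i, k)) by rewrite subKr.
by apply: full_tvB fii f; rewrite tr_delta_delta (negbTE ij) andbF.
Qed.

Lemma full_tv_delta_col i j k : i != j -> k != j -> full_tv 'E_(i, j) 'E_(k, j).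
Proof.
move=> ij kj; have jk : j != k by rewrite eq_sym.
have ji : j != i by rewrite eq_sym.
have [_ fjj] := full_tv_delta_diag ij.
have gK : (1%:M - 'E_(k, j)) *m (1%:M + 'E_(k, j)) = 1%:M.
  by rewrite mulmxBl !mulmxDr !mul1mx !mulmx1 mul_delta_mx_0 // addr0 addrK.
have := full_tv_GL gK fjj.
rewrite ![(1%:M + _) *m _]mulmxDl !mul1mx mul_delta_mx_0 // mul_delta_mx.
rewrite !addr0 !mulmxBr !mulmx1 mulmxDl !(mul_delta_mx_0 _ _ _ jk) !addr0 !subr0.
move=> f; have -> : 'E_(k, j) = 'E_(j, j) + 'E_(k, j) - 'E_(j, j) by rewrite addrC addKr.
by apply: full_tvB f fjj; rewrite !tr_deltaE (negbTE ji) /=; ring.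
Qed.

(** The pairs not covered by the preceding lemmas come from commutators: of
    (E_ij, E_ik) and (E_ki, E_kl) when k is neither i nor j, and of (E_ij, E_lj)
    and (E_jl, E_jl) when k = j. *)
Lemma full_tv_delta_off i j k l : i != j -> (k, l) != (j, i) ->
  full_tv 'E_(i, j) 'E_(k, l).
Proof.
move=> ij kl; have ji : j != i by rewrite eq_sym.
have [->|ki] := eqVneq k i.
  have [->|li] := eqVneq l i; first by case: (full_tv_delta_diag ij).
  exact: full_tv_delta_row.
have [kj|kj] := eqVneq k j.
  move: kl; rewrite kj xpair_eqE eqxx /= => li.
  have [->|lj] := eqVneq l j; first by case: (full_tv_delta_diag ij).
  have jl : j != l by rewrite eq_sym.
  apply: (full_tv_commutator _ _ _ _ (full_tv_delta_col ij lj) (full_tv_delta jl)).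
  - by rewrite tr_delta_delta (negbTE ji).
  - by rewrite tr_delta_delta (negbTE lj).
  - by rewrite tr_delta_delta (negbTE li).
  - by rewrite tr_delta_delta !eqxx oner_eq0.
have fkl : full_tv 'E_(k, i) 'E_(k, l).
  have [->|lk] := eqVneq l k; first by case: (full_tv_delta_diag ki).
  exact: full_tv_delta_row.
apply: (full_tv_commutator _ _ _ _ (full_tv_delta_row ij ki) fkl).
- by rewrite tr_delta_delta (negbTE ki).
- by rewrite tr_delta_delta (negbTE ki) andbF.
- by rewrite tr_delta_delta (negbTE kj) andbF.
- by rewrite tr_delta_delta !eqxx oner_eq0.
Qed.

Lemma full_tv_delta_all i j k l : (k, l) != (j, i) -> full_tv 'E_(i, j) 'E_(k, l).
Proof.
have [<-|ij] := eqVneq i j; last exact: full_tv_delta_off.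
have [<-|kl] := eqVneq k l; last first.
  move=> _; apply/full_tv_sym/full_tv_delta_off => //.
  by apply: contra_neq kl => -[-> ->].
rewrite xpair_eqE andbb => ki; have ik : i != k by rewrite eq_sym.
apply: (full_tv_commutator (P := 'E_(k, i)) (Q' := 'E_(i, k))).
- by rewrite tr_delta_delta (negbTE ki) andbF.
- by rewrite tr_delta_delta (negbTE ki).
- by rewrite tr_delta_delta (negbTE ki).
- by rewrite tr_delta_delta !eqxx oner_eq0.
- by apply/full_tv_sym/full_tv_delta_off; rewrite // xpair_eqE eqxx (negbTE ik).
- by apply: full_tv_delta_off; rewrite // xpair_eqE eqxx (negbTE ki).
Qed.

(** * From matrix units to the special linear group *)

Lemma delta_basis : exists e : (\dim {:'M[K]_n}).-tuple 'M[K]_n,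
  basis_of {:'M[K]_n} e /\
  exists f : 'I_(\dim {:'M[K]_n}) -> 'I_n * 'I_n,
    injective f /\ forall k : 'I_(\dim {:'M[K]_n}), e`_k = 'E_((f k).1, (f k).2).
Proof.
pose s := enum {: 'I_n * 'I_n}; pose E (p : 'I_n * 'I_n) := 'E_(p.1, p.2).
have sz : size (map E s) == \dim {:'M[K]_n}.
  by rewrite size_map -cardE card_prod card_ord dim_Mn -mulnn.
have szs : size s = \dim {:'M[K]_n} by rewrite -(eqP sz) size_map.
exists (Tuple sz); split.
  rewrite basisEdim /= (eqP sz) leqnn andbT.
  apply/subvP=> X _; rewrite [X]matrix_sum_delta.
  apply: memv_suml => i _; apply: memv_suml => j _; apply: memvZ.
  by apply: memv_span; apply/mapP; exists (i, j); rewrite ?mem_enum.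
exists (fun k => tnth (Tuple (introT eqP szs)) k); split.
  by apply/tuple_uniqP; apply: enum_uniq.
move=> k; have [i0 _] : exists i : 'I_n * 'I_n, true.
  by exists (tnth (Tuple (introT eqP szs)) k).
by rewrite (nth_map i0) ?szs // (tnth_nth i0).
Qed.

(** Under the trace form, the dual basis of the matrix units is their transposes. *)
Lemma coord_delta_basis (e : (\dim {:'M[K]_n}).-tuple 'M[K]_n) f :
  basis_of {:'M[K]_n} e -> injective f ->
  (forall k : 'I_(\dim {:'M[K]_n}), e`_k = 'E_((f k).1, (f k).2)) ->
  forall k X, coord e k X = \tr ('E_((f k).2, (f k).1) *m X).
Proof.
move=> eB f_inj ef k X; rewrite [X in RHS](coord_basis eB) ?memvf //.
rewrite mulmx_sumr raddf_sum /= (bigD1 k) //= big1 => [|l lk];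
  rewrite ef -scalemxAr mxtraceZ tr_delta_delta.
  by rewrite !eqxx mulr1 addr0.
by rewrite -xpair_eqE -!surjective_pairing (inj_eq f_inj) eq_sym (negbTE lk) mulr0.
Qed.

Lemma JMS_det1 (F : 'End('M[K]_n)) : endo_det F = 1 -> JMS F.
Proof.
have [e [eB [f [f_inj ef]]]] := delta_basis.
rewrite -(endo_detE F eB) -[F in JMS F](mxofK eB eB).
move: (mxof e e F); apply: SL_elementary; split=> [|A B SA SB|i j t ij].
- apply/JMS_of_jms/(eq_jms _ jms_id) => X.
  by rewrite (hommx1 eB) id_lfunE.
- by rewrite (hommx_mul eB eB eB); apply: JMS_comp.
- rewrite -elem_transvectionE //; apply: JMS_of_jms.
  have /full_tv_delta_all/(_ t) :
      ((f i).2, (f i).1) != ((f j).2, (f j).1).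
    apply: contra_neq ij => -[f2 f1]; apply: f_inj.
    by rewrite [f i]surjective_pairing f1 f2 -surjective_pairing.
  apply: eq_jms => X; rewrite add_lfunE id_lfunE scale_lfunE lfunE /= /elem_fun.
  rewrite ef (coord_delta_basis eB f_inj ef) /tv -scalemxAl mxtraceZ.
  by rewrite scalerA.
Qed.

End Jordan.

Theorem theorem1p2 (K : fieldType) (n : nat)
    (charK : 2%N \notin [pchar K]) (n_ge2 : (2 <= n)%N) :
  (forall f : 'End('M[K]_n), in_SL f -> JMS f) /\
  (forall b : (\dim {:'M[K]_n}).-tuple 'M[K]_n, basis_of {:'M[K]_n} b ->
    (forall (i j : 'I_(\dim {:'M[K]_n})) (t : K), i != j ->
       JMS (elem_transvection b i j t)) /\
    (forall M : 'M[K]_(\dim {:'M[K]_n}), \det M = 1 -> JMS (hommx b b M^T))).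
Proof.
have JSL := JMS_det1 charK; split=> [f [_ /JSL] //|b bB].
have JM (M : 'M[K]_(\dim {:'M[K]_n})) : \det M = 1 -> JMS (hommx b b M).
  by move=> detM; apply: JSL; rewrite -(endo_detE _ bB) hommxK.
split=> [i j t ij|M detM]; last by apply: JM; rewrite det_tr.
rewrite (elem_transvectionE _ _ _ bB); apply/JM/det_elementary.
by rewrite eq_sym.
Qed.
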